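(* A homogeneous binary sextic $F$ over $\mathbb{C}$ can be written as the cube of a quadratic form if and only if the covariants $$(F,H),\qquad (F,i)\qquad\text{and}\qquad 8\,F\,(F,F)^6-75\,(F,i)^2$$ all vanish on $F$, where $H=(F,F)^2$ and $i=(F,F)^4$.
   Context: All forms are in the variables $x,y$ over $\mathbb{C}$. For binary forms $\Phi_1,\Phi_2$ of degrees $q_1,q_2$ and $1\le r\le\min(q_1,q_2)$, $(\Phi_1,\Phi_2)^r$ denotes the $r$-th transvectant, a binary form of degree $q_1+q_2-2r$, normalized by the symbolic method: it is bilinear in $(\Phi_1,\Phi_2)$ and for powers of linear forms $$\big((\alpha_1x+\alpha_2y)^{q_1},(\beta_1x+\beta_2y)^{q_2}\big)^r=(\alpha_1\beta_2-\alpha_2\beta_1)^r(\alpha_1x+\alpha_2y)^{q_1-r}(\beta_1x+\beta_2y)^{q_2-r}.$$ (In other words: if $\Phi_i=\sum_k\varphi_{ik}x^ky^{q_i-k}$, expand the right-hand side and substitute $\varphi_{1k}$ for $\binom{q_1}{k}\alpha_1^k\alpha_2^{q_1-k}$ and $\varphi_{2k}$ for $\binom{q_2}{k}\beta_1^k\beta_2^{q_2-k}$.) $(\Phi_1,\Phi_2)$ without superscript means $(\Phi_1,\Phi_2)^1$. Here $H$ has degree $8$, $i$ has degree $4$, and $(F,F)^6$ has degree $0$ in $x,y$. A covariant ''vanishes on $F$'' if it is identically zero as a polynomial in $x,y$ when evaluated at $F$. *)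

(* Defs.v *)
From HB Require Import structures.
From mathcomp Require Import all_boot all_order all_algebra.
From mathcomp Require Import reals complex mpoly zify ring.

Set Implicit Arguments.
Unset Strict Implicit.
Unset Printing Implicit Defensive.

Import GRing.Theory Num.Theory.
Local Open Scope ring_scope.

(* A binary form of degree q is an f : {mpoly K[2]} with f \is q.-homog
   (so 0 is a form of every degree). *)

Definition varx {K : fieldType} : {mpoly K[2]} := 'X_ord0.
Definition vary {K : fieldType} : {mpoly K[2]} := 'X_ord_max.

(* The symbolic counterpart of alpha_1^k alpha_2^(q-k) for a form f of degree q:
   the coefficient of x^k y^(q-k) divided by 'C(q, k). *)
Definition ncoef {K : fieldType} (q : nat) (f : {mpoly K[2]}) (k : nat) : K :=
  f@_[multinom [:: k; (q - k)%N]] / 'C(q, k)%:R.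

(* The expansion of
     (alpha_1 beta_2 - alpha_2 beta_1)^r
       (alpha_1 x + alpha_2 y)^(q1-r) (beta_1 x + beta_2 y)^(q2-r)
   in which alpha_1^k alpha_2^(q1-k) is replaced by ncoef q1 f k and
   beta_1^k beta_2^(q2-k) by ncoef q2 g k.  Meaningful for f, g forms of degrees
   q1, q2 and r <= minn q1 q2; see transvectant_pow and the linearity lemmas. *)
Definition transvectant {K : fieldType} (q1 q2 r : nat) (f g : {mpoly K[2]}) :
    {mpoly K[2]} :=
  \sum_(j < r.+1) \sum_(a < (q1 - r).+1) \sum_(b < (q2 - r).+1)
    ((-1) ^+ j * 'C(r, j)%:R * 'C(q1 - r, a)%:R * 'C(q2 - r, b)%:R
       * ncoef q1 f (r - j + a) * ncoef q2 g (j + b))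
    *: (varx ^+ (a + b) * vary ^+ ((q1 - r - a) + (q2 - r - b))).

Definition linform {K : fieldType} (c d : K) : {mpoly K[2]} :=
  c *: varx + d *: vary.

Lemma ncoef_linear (K : fieldType) (q k : nat) (c : K) (f g : {mpoly K[2]}) :
  ncoef q (c *: f + g) k = c * ncoef q f k + ncoef q g k.
Proof. by rewrite /ncoef mcoeffD mcoeffZ mulrDl mulrA. Qed.

Lemma transvectant_linearl (K : fieldType) (q1 q2 r : nat) (c : K)
    (f f' g : {mpoly K[2]}) :
  transvectant q1 q2 r (c *: f + f') g =
  c *: transvectant q1 q2 r f g + transvectant q1 q2 r f' g.
Proof.
rewrite /transvectant; do 3!(rewrite scaler_sumr -big_split; apply: eq_bigr => ? _).
rewrite /= ncoef_linear scalerA -scalerDl; congr (_ *: _); ring.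
Qed.

Lemma transvectant_linearr (K : fieldType) (q1 q2 r : nat) (c : K)
    (f g g' : {mpoly K[2]}) :
  transvectant q1 q2 r f (c *: g + g') =
  c *: transvectant q1 q2 r f g + transvectant q1 q2 r f g'.
Proof.
rewrite /transvectant; do 3!(rewrite scaler_sumr -big_split; apply: eq_bigr => ? _).
rewrite /= ncoef_linear scalerA -scalerDl; congr (_ *: _); ring.
Qed.

Lemma linform_exp (K : fieldType) (c d : K) (n : nat) :
  linform c d ^+ n = \sum_(a < n.+1)
    ('C(n, a)%:R * c ^+ a * d ^+ (n - a)) *: (varx ^+ a * vary ^+ (n - a)).
Proof.
rewrite /linform addrC exprDn; apply: eq_bigr => a _.
by rewrite !exprZn -scalerAl -scalerAr scalerA -scaler_nat scalerA
  [vary ^+ _ * _]mulrC; congr (_ *: _); ring.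
Qed.

Lemma ncoef_linform (K : numFieldType) (c d : K) (q k : nat) :
  (k <= q)%N -> ncoef q (linform c d ^+ q) k = c ^+ k * d ^+ (q - k).
Proof.
move=> lekq; rewrite /ncoef linform_exp raddf_sum /=.
have Xab a b : varx ^+ a * vary ^+ b = 'X_[[multinom [:: a; b]]] :> {mpoly K[2]}.
  rewrite /varx /vary !mpolyXn -mpolyXD; congr 'X_[_]; apply/mnmP => i.
  rewrite mnmDE !mulmnE !mnm1E multinomE (tnth_nth 0%N) /=.
  by case: i => [[|[|]]] //= ?; rewrite !(mul0n, mul1n, addn0).
have ltkq : (k < q.+1)%N by [].
rewrite (bigD1 (Ordinal ltkq)) //= big1 => [|a neq_ak].
  have nzC : 'C(q, k)%:R != 0 :> K by rewrite pnatr_eq0 -lt0n bin_gt0.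
  by rewrite addr0 mcoeffZ Xab mcoeffX eqxx mulr1; field.
rewrite mcoeffZ Xab mcoeffX; case: eqP => [/mnmP/(_ ord0)|_]; last by rewrite mulr0.
rewrite !multinomE !(tnth_nth 0%N) /= => eq_ak.
by case/eqP: neq_ak; apply: val_inj.
Qed.

Lemma transvectant_pow (K : numFieldType) (q1 q2 r : nat) (a1 a2 b1 b2 : K) :
  (r <= minn q1 q2)%N ->
  transvectant q1 q2 r (linform a1 a2 ^+ q1) (linform b1 b2 ^+ q2) =
  (a1 * b2 - a2 * b1) ^+ r *:
    (linform a1 a2 ^+ (q1 - r) * linform b1 b2 ^+ (q2 - r)).
Proof.
rewrite leq_min => /andP[le_rq1 le_rq2].
rewrite exprBn scaler_suml; apply: eq_bigr => j _.
rewrite (linform_exp _ _ (q1 - r)) (linform_exp _ _ (q2 - r)).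
rewrite mulr_suml scaler_sumr; apply: eq_bigr => a _.
rewrite mulr_sumr scaler_sumr; apply: eq_bigr => b _.
have := ltn_ord j; have := ltn_ord a; have := ltn_ord b; rewrite !ltnS => lb la lj.
rewrite !ncoef_linform.
- rewrite -scalerAl -scalerAr !scalerA; congr (_ *: _); last first.
    by rewrite !exprD; ring.
  have -> : (q1 - (r - j + a) = j + (q1 - r - a))%N by lia.
  have -> : (q2 - (j + b) = (r - j) + (q2 - r - b))%N by lia.
  by rewrite -mulr_natr !exprMn !exprD; ring.
- lia.
- lia.
Qed.

(* Main.v *)
From HB Require Import structures.
Require Import Defs.
From mathcomp Require Import all_boot all_order all_algebra.
From mathcomp Require Import reals complex mpoly zify ring.
Set Implicit Arguments.
Unset Strict Implicit.
Unset Printing Implicit Defensive.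
Import GRing.Theory Num.Theory.
Local Open Scope ring_scope.

(** All three covariants vanish on cubes because each is built from the
    discriminant and powers of the quadratic form; conversely, the equation
    (F,H) = 0 forces every root of F to have multiplicity 3 or 6.

    Everything is computed on the dehomogenised form f(X) = F(X,1).  Write D_s f
    for the normalised derivative (q-s)!/q! f^(s) of a form of degree q
    ([pder]).  The normalised coefficients of F are the D_s f at the origin, and
    transvectants commute with translations of X, so
      (F,G)^r (X,1) = \sum_j (-1)^j C(r,j) D_(r-j) f  D_j g
    for all X, and not only at X = 0: this is [dehom_transvectant].

    If F = Q^3, put q(X) = Q(X,1) and e_s = D_s q.  The D_s f are explicit
    polynomials in e_0, e_1, e_2 ([cube_jet]), and every covariant at hand becomes
    a power of the discriminant e_0 e_2 - e_1^2, which is constant, times a power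
    of e_0.  Thus H is a multiple of Q^4 and i a multiple of Q^2, whose Jacobians
    with Q^3 vanish, and the third covariant is a multiple of Q^3 whose
    coefficient cancels.

    Conversely, let h be 6 f f'' - 5 f'^2, which is H(X,1) up to a constant.  Then
    (F,H) = 0 reads 3 f h' = 4 h f', so that f^4 and h^3 are proportional when
    h is nonzero.  At a root of f of multiplicity m > 0, comparing leading terms gives
    (m - 6) (m - 3) = 0 ([multiplicity_of_hessian_ode]): every root has
    multiplicity 3 or 6, so f is a constant times a cube of a polynomial, hence a
    cube over an algebraically closed field.  The root at infinity takes care of
    itself: f = q^3 has degree at most 6, so q has degree at most 2 and is the
    dehomogenisation of a quadratic form. *)

(** * Alternating binomial sums *)

Section AltSum.
Variable A : comNzRingType.

(** [G i j] is only sampled on i + j = r. *)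
Definition altsum (r : nat) (G : nat -> nat -> A) : A :=
  \sum_(j < r.+1) (-1) ^+ j * 'C(r, j)%:R * G (r - j)%N j.

Lemma altsum0 G : altsum 0 G = G 0%N 0%N.
Proof. by rewrite /altsum big_ord1 expr0 bin0 !mul1r. Qed.

(** Pascal's rule, which makes inductions on the order of a transvectant possible. *)
Lemma altsumS r G :
  altsum r.+1 G = altsum r (fun i j => G i.+1 j) - altsum r (fun i j => G i j.+1).
Proof.
rewrite /altsum big_ord_recl [X in _ = X - _]big_ord_recl /= !bin0 !subn0 -addrA.
congr (_ + _); rewrite -sumrN.
under eq_bigr => j _ do rewrite /bump /= add1n binS natrD subSS mulrDr mulrDl.
rewrite big_split /=; congr (_ + _); last first.
  by apply: eq_bigr => j _; rewrite exprS; ring.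
rewrite big_ord_recr /= bin_small // mulr0 mul0r addr0.
by apply: eq_bigr => j _; rewrite /bump /= add1n subnSK.
Qed.

Lemma eq_altsum r G G' :
  (forall i j, i + j = r -> G i j = G' i j)%N -> altsum r G = altsum r G'.
Proof. by move=> eqG; apply: eq_bigr => j _; rewrite eqG // subnK // -ltnS. Qed.

Lemma altsumD r G G' :
  altsum r (fun i j => G i j + G' i j) = altsum r G + altsum r G'.
Proof. by rewrite /altsum -big_split; apply: eq_bigr => j _; rewrite mulrDr. Qed.

Lemma altsumZ r a G : altsum r (fun i j => a * G i j) = a * altsum r G.
Proof. by rewrite /altsum mulr_sumr; apply: eq_bigr => j _; ring. Qed.

Lemma altsum1 G : altsum 1 G = G 1%N 0%N - G 0%N 1%N.
Proof. by rewrite !altsumS !altsum0. Qed.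

Lemma altsum2 G : altsum 2 G = G 2%N 0%N - G 1%N 1%N *+ 2 + G 0%N 2%N.
Proof. by rewrite !altsumS !altsum0; ring. Qed.

Lemma altsum4 G : altsum 4 G =
  G 4%N 0%N - G 3%N 1%N *+ 4 + G 2%N 2%N *+ 6 - G 1%N 3%N *+ 4 + G 0%N 4%N.
Proof. by rewrite !altsumS !altsum0; ring. Qed.

Lemma altsum6 G : altsum 6 G =
  G 6%N 0%N - G 5%N 1%N *+ 6 + G 4%N 2%N *+ 15 - G 3%N 3%N *+ 20
    + G 2%N 4%N *+ 15 - G 1%N 5%N *+ 6 + G 0%N 6%N.
Proof. by rewrite !altsumS !altsum0; ring. Qed.

End AltSum.

(** * Normalised coefficient sequences *)

Section BinomialForm.
Variable K : numFieldType.
Implicit Types u v : nat -> K.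

(** If [u] lists the normalised coefficients of a form of degree q, this is, at
    y = 1, the normalised mixed derivative of order [s] in x and q - [s] - [m] in
    y.  Keeping the degree [m] free of [s] lets both partial derivatives act
    without side conditions. *)
Definition binform (u : nat -> K) (m s : nat) : {poly K} :=
  \poly_(k < m.+1) ('C(m, k)%:R * u (s + k)%N).

Lemma coef_binform u m s k : (binform u m s)`_k = 'C(m, k)%:R * u (s + k)%N.
Proof. by rewrite coef_poly; case: ltnP => // /bin_small ->; rewrite mul0r. Qed.

(** Euler's identity m F = x F_x + y F_y at y = 1: it trades derivatives in y for
    derivatives in x. *)
Lemma binform_pascal u m s :
  binform u m.+1 s = binform u m s + 'X * binform u m s.+1.
Proof.
apply/polyP => k; rewrite coefD coefXM !coef_binform.
case: k => [|k] /=; first by rewrite !bin0 addr0.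
by rewrite binS natrD mulrDl addSnnS.
Qed.

Lemma deriv_binform0 u s : (binform u 0 s)^`() = 0.
Proof.
by apply/polyP => k; rewrite coef_deriv coef_binform coef0 bin_small // mul0r mul0rn.
Qed.

Lemma deriv_binform u m s : (binform u m.+1 s)^`() = m.+1%:R * binform u m s.+1.
Proof.
apply/polyP => k; rewrite coef_deriv mulr_natl coefMn !coef_binform addSnnS.
by rewrite -!mulrnAl -!mulrnA ![('C(_, _) * _)%N]mulnC -mul_bin_diag.
Qed.

(** The left side is the transvectant as defined, built from mixed derivatives of
    total order r; the right side involves derivatives in x only.  Symbolically,
    with d_i the derivative in x on the i-th factor, the derivative in y is
    1 - X d_i, and d_1 (1 - X d_2) - (1 - X d_1) d_2 = d_1 - d_2, since the two
    terms in X cancel. *)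
Lemma altsum_binform u v r m l s t :
  altsum r (fun i j => binform u m (s + i) * binform v l (t + j)) =
  altsum r (fun i j => binform u (m + j) (s + i) * binform v (l + i) (t + j)).
Proof.
elim: r m l s t => [|r IH] m l s t; first by rewrite !altsum0 !addn0.
rewrite !altsumS.
under [X in _ = X - _]eq_altsum => i j _ do rewrite -addSnnS -[(l + _)%N]addSnnS.
under [X in _ = _ - X]eq_altsum => i j _ do rewrite -addSnnS -[(t + _)%N]addSnnS.
rewrite -!IH.
under eq_altsum => i j _ do rewrite -addSnnS.
under [X in _ - X = _]eq_altsum => i j _ do rewrite -addSnnS.
under [X in _ = X - _]eq_altsum => i j _ do rewrite binform_pascal mulrDr mulrCA -addSn.
under [X in _ = _ - X]eq_altsum => i j _ do rewrite binform_pascal mulrDl -mulrA -addSn.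
rewrite !altsumD !altsumZ; ring.
Qed.
End BinomialForm.

(** * Dehomogenisation of binary forms *)

Section Dehom.
Variable K : numFieldType.
Implicit Types (F G : {mpoly K[2]}).

Definition dehom F : {poly K} :=
  mmap polyC (fun i : 'I_2 => if i == ord0 then 'X else 1) F.
HB.instance Definition _ := GRing.isZmodMorphism.Build {mpoly K[2]} {poly K} dehom
  (mmap_is_additive _ _).
Fact dehom_monoid_morphism : monoid_morphism dehom.
Proof. by split; [exact: rmorph1 | exact: rmorphM]. Qed.
HB.instance Definition _ := GRing.isMonoidMorphism.Build {mpoly K[2]} {poly K} dehom
  dehom_monoid_morphism.

Lemma dehom_mono c a b : dehom (c *: (varx ^+ a * vary ^+ b)) = c *: 'X^a.
Proof.
rewrite /dehom mmapZ rmorphM !rmorphXn /= /varx /vary !mmapX !mmap1U /=.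
by rewrite expr1n mulr1 mul_polyC.
Qed.

Lemma homog_mono a b : varx ^+ a * vary ^+ b \is [in K[2], (a + b).-homog].
Proof.
rewrite dhomogM // -[X in X.-homog]mul1n dhomogMn //.
all: by rewrite dhomogX; apply/eqP; apply: mdeg1.
Qed.

Lemma monoE a b : varx ^+ a * vary ^+ b = 'X_[[multinom [:: a; b]]] :> {mpoly K[2]}.
Proof.
rewrite /varx /vary !mpolyXn -mpolyXD; congr 'X_[_]; apply/mnmP => i.
rewrite mnmDE !mulmnE !mnm1E multinomE (tnth_nth 0%N) /=.
by case: i => [[|[|]]] //= ?; rewrite !(mul0n, mul1n, addn0).
Qed.

Lemma homogE q F : F \is q.-homog ->
  F = \sum_(k < q.+1)
        F@_[multinom [:: k : nat; (q - k)%N]] *: (varx ^+ k * vary ^+ (q - k)).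
Proof.
move=> hF; apply/mpolyP => m; rewrite raddf_sum /=.
under eq_bigr => k _ do rewrite monoE mcoeffZ mcoeffX.
have mE : m = [multinom [:: m ord0; m ord_max]].
  by apply/mnmP; case=> [[|[|]]] // lti; rewrite multinomE (tnth_nth 0%N) /=;
     congr (m _); apply: val_inj.
have dm : mdeg m = (m ord0 + m ord_max)%N.
  by rewrite mdegE big_ord_recl big_ord1; congr (_ + m _)%N; apply: val_inj.
have [mq|mq] := eqVneq (mdeg m) q.
  have lt0 : (m ord0 < q.+1)%N by rewrite -mq dm ltnS leq_addr.
  have max_q : (q - m ord0)%N = m ord_max by rewrite -mq dm addKn.
  rewrite (bigD1 (Ordinal lt0)) //= max_q -mE eqxx mulr1 big1 ?addr0 // => k nk.
  case: eqP => [km|]; last by rewrite mulr0.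
  case/eqP: nk; apply: val_inj => /=.
  by rewrite -km multinomE (tnth_nth 0%N).
rewrite (dhomog_nemf_coeff hF) // big1 // => k _; case: eqP => [km|]; last by rewrite mulr0.
case/eqP: mq; rewrite dm -km !multinomE !(tnth_nth 0%N) /= subnKC // -ltnS.
exact: ltn_ord.
Qed.

Lemma dehomE q F : F \is q.-homog ->
  dehom F = \poly_(k < q.+1) F@_[multinom [:: k; (q - k)%N]].
Proof.
move=> hF; rewrite {1}(homogE hF) rmorph_sum poly_def /=.
by apply: eq_bigr => k _; rewrite dehom_mono.
Qed.

Lemma dehom_inj q F G :
  F \is q.-homog -> G \is q.-homog -> dehom F = dehom G -> F = G.
Proof.
move=> hF hG; rewrite (dehomE hF) (dehomE hG) => /polyP eqFG.
rewrite (homogE hF) (homogE hG); apply: eq_bigr => k _.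
by have := eqFG k; rewrite !coef_poly ltn_ord => ->.
Qed.

Lemma dehom_surj q (p : {poly K}) : (size p <= q.+1)%N ->
  exists2 F : {mpoly K[2]}, F \is q.-homog & dehom F = p.
Proof.
move=> szp; exists (\sum_(k < q.+1) p`_k *: (varx ^+ k * vary ^+ (q - k))).
  apply: rpred_sum => k _; apply: dhomogZ.
  by have := homog_mono k (q - k); rewrite subnKC // -ltnS.
rewrite rmorph_sum /=; under eq_bigr => k _ do rewrite dehom_mono.
rewrite -poly_def; apply/polyP => k; rewrite coef_poly; case: ltnP => // lqk.
by rewrite nth_default // (leq_trans szp).
Qed.

Lemma homog_transvectant q1 q2 r F G :
  transvectant q1 q2 r F G \is (q1 - r + (q2 - r)).-homog.
Proof.
apply: rpred_sum => j _; apply: rpred_sum => a _; apply: rpred_sum => b _.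
apply: dhomogZ; have /ltnSE la := ltn_ord a; have /ltnSE lb := ltn_ord b.
have := homog_mono (a + b) ((q1 - r - a) + (q2 - r - b)).
by rewrite addnACA !subnKC.
Qed.

(** The dehomogenised derivative (q-s)!/q! d^s F / dx^s. *)
Definition pder q s F : {poly K} := binform (ncoef q F) (q - s) s.

Lemma pder0 q F : F \is q.-homog -> pder q 0 F = dehom F.
Proof.
move=> hF; apply/polyP => k; rewrite (dehomE hF) coef_binform coef_poly subn0.
case: ltnP => [lkq|/bin_small->]; last by rewrite mul0r.
by rewrite add0n /ncoef mulrC divfK // pnatr_eq0 -lt0n bin_gt0.
Qed.

Lemma deriv_pder q s F : (s < q)%N ->
  (pder q s F)^`() = pder q s.+1 F *+ (q - s).
Proof. by move=> lsq; rewrite /pder -subnSK // deriv_binform mulr_natl. Qed.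

(** Translation covariance of transvectants: the formula that the definition gives
    for the value at X = 0 holds for every X. *)
Lemma dehom_transvectant q1 q2 r F G : (r <= q1)%N -> (r <= q2)%N ->
  dehom (transvectant q1 q2 r F G) =
  altsum r (fun i j => pder q1 i F * pder q2 j G).
Proof.
move=> le1 le2; transitivity (altsum r (fun i j =>
    binform (ncoef q1 F) (q1 - r) (0 + i) * binform (ncoef q2 G) (q2 - r) (0 + j))).
  rewrite rmorph_sum; apply: eq_bigr => j _; rewrite rmorph_sum /= /binform !poly_def.
  rewrite mulr_suml mulr_sumr; apply: eq_bigr => a _.
  rewrite rmorph_sum /= mulr_sumr mulr_sumr; apply: eq_bigr => b _.
  by rewrite dehom_mono -!mul_polyC exprD !rmorphM /= rmorphXn /= rmorphN1 !rmorph_nat; ring.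
rewrite altsum_binform; apply: eq_altsum => i j ijr.
rewrite /pder !add0n; congr (binform _ _ _ * binform _ _ _); lia.
Qed.
End Dehom.

(** * Polynomials all of whose roots have multiplicity divisible by three *)

(** With u = X - a, the polynomial h has leading term m (m - 6) g(a)^2 u^(2m-2) at
    a.  If this is nonzero, the logarithmic derivatives in 3 h'/h = 4 f'/f have
    residues 3 (2m - 2) and 4m at a, so that m = 3; otherwise m is 0 or 6. *)
Lemma multiplicity_of_hessian_ode (K : numFieldType) (f g h : {poly K}) (a : K)
    (m : nat) :
  h = f * f^`()^`() *+ 6 - f^`() ^+ 2 *+ 5 ->
  f^`() * h *+ 4 = f * h^`() *+ 3 ->
  f = ('X - a%:P) ^+ m * g -> g.[a] != 0 -> (3 %| m)%N.
Proof.
move=> hE ode; set u := 'X - a%:P => fE ga.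
have u'1 : u^`() = 1 by rewrite derivXsubC.
have ua : u.[a] = 0 by rewrite hornerXsubC subrr.
have u0 : u != 0 by rewrite polyXsubC_eq0.
clearbody u.
(* Using u d/dX in place of d/dX keeps all powers of u nonnegative, so small
   values of m need no separate treatment. *)
have euler n p : u * (u ^+ n * p)^`() = u ^+ n * (p *+ n + u * p^`()).
  rewrite derivM deriv_exp u'1 mul1r; case: n => [|n] /=; last by rewrite !exprS; ring.
  by rewrite expr0; ring.
pose f1 := g *+ m + u * g^`().
have f'E : u * f^`() = u ^+ m * f1 by rewrite fE euler.
have f''E : u ^+ 2 * f^`()^`() = u ^+ m * (f1 *+ m + u * f1^`() - f1).
  have := euler m f1; rewrite -f'E derivM u'1 mul1r => E.
  have -> : u ^+ 2 * f^`()^`() = u * (f^`() + u * f^`()^`()) - u * f^`() by ring.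
  by rewrite E f'E; ring.
pose k := g * (f1 *+ m + u * f1^`() - f1) *+ 6 - f1 ^+ 2 *+ 5.
have hkE : u ^+ 2 * h = u ^+ (m + m) * k.
  have -> : u ^+ 2 * h = f * (u ^+ 2 * f^`()^`()) *+ 6 - (u * f^`()) ^+ 2 *+ 5.
    by rewrite hE; ring.
  by rewrite f''E f'E fE exprD /k; ring.
have h'E : u ^+ 3 * h^`() = u ^+ (m + m) * (k *+ (m + m) + u * k^`() - k *+ 2).
  have := euler (m + m)%N k; rewrite -hkE derivM deriv_exp u'1 /= expr1 mul1r => E.
  have -> : u ^+ 3 * h^`() = u * (u *+ 2 * h + u ^+ 2 * h^`()) - u ^+ 2 * h *+ 2.
    by ring.
  by rewrite E hkE; ring.
have E : u ^+ (m + m + m) * (k * f1 *+ 4) =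
         u ^+ (m + m + m) * (g * (k *+ (m + m) + u * k^`() - k *+ 2) *+ 3).
  have := congr1 (fun p => u ^+ 3 * p) ode => /=.
  have -> : u ^+ 3 * (f^`() * h *+ 4) = u * f^`() * (u ^+ 2 * h) *+ 4 by ring.
  have -> : u ^+ 3 * (f * h^`() *+ 3) = f * (u ^+ 3 * h^`()) *+ 3 by ring.
  rewrite f'E hkE h'E fE => E; rewrite [u ^+ (_ + m)]exprD.
  transitivity (u ^+ m * f1 * (u ^+ (m + m) * k) *+ 4); first by ring.
  by rewrite E; ring.
move/mulfI: E; rewrite expf_neq0 // => /(_ isT) E.
have evalE := (hornerD, hornerN, hornerM, hornerMn, horner_exp).
have f1a : f1.[a] = g.[a] *+ m by rewrite /f1 !evalE ua mul0r addr0.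
clearbody f1; have ka : k.[a] = (m%:R ^+ 2 - m%:R *+ 6) * g.[a] ^+ 2.
  by rewrite /k !evalE ua f1a; ring.
clearbody k; have {E} := congr1 (fun p => p.[a]) E => /=; rewrite !evalE ua f1a ka => E.
have {}E : g.[a] ^+ 3 * (m%:R * (m%:R - 6%:R) * (m%:R - 3%:R)) *+ 2 = 0 :> K.
  by move/eqP: E; rewrite eq_sym -subr_eq0 => /eqP <-; rewrite mulrnDr; ring.
move/eqP: E; rewrite mulrn_eq0 /= mulf_eq0 expf_eq0 (negPf ga) /=.
by rewrite !mulf_eq0 !subr_eq0 !eqr_nat pnatr_eq0 => /orP[/orP[]|] /eqP->.
Qed.

(** Splitting off one root at a time; the constant that remains has a cube root. *)
Lemma poly_cube_of_multiplicities (K : numClosedFieldType) (p : {poly K}) :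
  (forall a m g, p = ('X - a%:P) ^+ m * g -> g.[a] != 0 -> (3 %| m)%N) ->
  exists q, p = q ^+ 3.
Proof.
have [n] := ubnP (size p); elim: n p => // n IH p lpn mp.
have [->|p0] := eqVneq p 0; first by exists 0; rewrite expr0n.
have [/eqP/size_poly1P[c _ ->]|] := eqVneq (size p) 1%N.
  by exists ((3.-root c)%:P); rewrite -rmorphXn /= rootCK.
move=> /closed_rootP[a pa0].
have [m [g /implyP/(_ p0) ga pE]] := multiplicity_XsubC p a.
rewrite mulrC in pE; have /dvdnP[k mE] := mp a m g pE ga.
have m0 : (0 < m)%N.
  by case: m pE {mE} => // pE; move: ga; rewrite -[g]mul1r -(expr0 ('X - a%:P)) -pE pa0.
have [||q gE] := IH g.
- move: lpn; rewrite pE mulrC size_Mmonic ?monic_exp ?monicXsubC //; last first.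
    by apply: contraNneq p0 => g0; rewrite pE g0 mulr0.
  rewrite size_exp_XsubC; lia.
- move=> b l g' gE g'b; have [ab|ba] := eqVneq b a.
    case: l gE => // l gE; move: ga.
    by rewrite gE ab exprS /root !hornerE subrr !mul0r eqxx.
  apply: (mp b l (('X - a%:P) ^+ m * g')); first by rewrite pE gE mulrCA.
  by rewrite !hornerE mulf_neq0 // expf_neq0 // subr_eq0.
by exists (('X - a%:P) ^+ k * q); rewrite exprMn -exprM -mE -gE.
Qed.

(** * The covariants of the cube of a quadratic form *)

Section Cubes.
Variable K : numFieldType.
Implicit Types (F Q : {mpoly K[2]}).

Lemma polyMn_inj n : injective (fun p : {poly K} => p *+ n.+1).
Proof.
by move=> p q /eqP; rewrite -!scaler_nat (inj_eq (scalerI _)) ?pnatr_eq0 // => /eqP.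
Qed.

Lemma deriv_quad Q (e := fun i => pder 2 i Q) :
  [/\ (e 0%N)^`() = e 1%N *+ 2, (e 1%N)^`() = e 2%N & (e 2%N)^`() = 0].
Proof. by split; [exact: deriv_pder | exact: deriv_pder | exact: deriv_binform0]. Qed.

(** The discriminant of a quadratic form, up to a factor: the expression e_0 e_2 -
    e_1^2 in X, which is constant by [deriv_discr]. *)
Definition discr Q : {poly K} := pder 2 0 Q * pder 2 2 Q - pder 2 1 Q ^+ 2.

Lemma deriv_discr Q : (discr Q)^`() = 0.
Proof.
rewrite /discr; have [e0' e1' e2'] := deriv_quad Q.
by rewrite expr2 !(derivD, derivN, derivM) e0' e1' e2'; ring.
Qed.

(** Each equation after the first is the derivative of the one before it, divided
    by the integer 6 - s that differentiating D_s brings out. *)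
Lemma cube_jet Q (e := fun i => pder 2 i Q) (d := fun i => pder 6 i (Q ^+ 3)) :
  Q \is 2.-homog ->
  [/\ d 0%N = e 0%N ^+ 3, d 1%N = e 0%N ^+ 2 * e 1%N,
      d 2%N *+ 5 = e 0%N * e 1%N ^+ 2 *+ 4 + e 0%N ^+ 2 * e 2%N,
      d 3%N *+ 5 = e 1%N ^+ 3 *+ 2 + e 0%N * e 1%N * e 2%N *+ 3
    & [/\ d 4%N *+ 5 = e 1%N ^+ 2 * e 2%N *+ 4 + e 0%N * e 2%N ^+ 2,
      d 5%N = e 1%N * e 2%N ^+ 2 & d 6%N = e 2%N ^+ 3]].
Proof.
move=> hQ.
have hF : Q ^+ 3 \is 6.-homog by apply: (dhomogMn 3 hQ).
have [] := deriv_quad Q; rewrite -/(e 0%N) -/(e 1%N) -/(e 2%N) => e0' e1' e2'.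
have d' s : (s < 6)%N -> (d s)^`() = d s.+1 *+ (6 - s) by exact: deriv_pder.
have diffE := (derivD, derivMn, derivM, exprS, expr0, mulr1, e0', e1', e2').
have E0 : d 0%N = e 0%N ^+ 3 by rewrite /d /e !pder0 // rmorphXn.
have E1 : d 1%N = e 0%N ^+ 2 * e 1%N.
  by apply: (@polyMn_inj 5); rewrite /= -(d' 0%N) // E0 !diffE; ring.
have E2 : d 2%N *+ 5 = e 0%N * e 1%N ^+ 2 *+ 4 + e 0%N ^+ 2 * e 2%N.
  by rewrite -(d' 1%N) // E1 !diffE; ring.
have E3 : d 3%N *+ 5 = e 1%N ^+ 3 *+ 2 + e 0%N * e 1%N * e 2%N *+ 3.
  apply: (@polyMn_inj 3); rewrite /= mulrnAC -(d' 2%N) // -derivMn E2 !diffE; ring.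
have E4 : d 4%N *+ 5 = e 1%N ^+ 2 * e 2%N *+ 4 + e 0%N * e 2%N ^+ 2.
  apply: (@polyMn_inj 2); rewrite /= mulrnAC -(d' 3%N) // -derivMn E3 !diffE; ring.
have E5 : d 5%N = e 1%N * e 2%N ^+ 2.
  apply: (@polyMn_inj 9); rewrite /= (mulrnA _ 2 5) -(d' 4%N) // -derivMn E4 !diffE.
  ring.
have E6 : d 6%N = e 2%N ^+ 3.
  by rewrite -[LHS](d' 5%N) // E5 !diffE; ring.
by [].
Qed.

Section CovariantsOfCube.
Variables (Q : {mpoly K[2]}) (hQ : Q \is 2.-homog).
Let F := Q ^+ 3.
Let H := transvectant 6 6 2 F F.
Let i := transvectant 6 6 4 F F.
Local Notation e j := (pder 2 j Q).
Local Notation D := (discr Q).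

Let hF : F \is 6.-homog. Proof. exact: (dhomogMn 3 hQ). Qed.
Let hH : H \is 8.-homog. Proof. exact: homog_transvectant. Qed.
Let hi : i \is 4.-homog. Proof. exact: homog_transvectant. Qed.

(** H is a constant multiple of D Q^4. *)
Lemma cube_hessian : pder 8 0 H *+ 5 = D * e 0 ^+ 4 *+ 2.
Proof.
rewrite pder0 // dehom_transvectant // altsum2 /discr.
have [-> -> E2 _ _] := cube_jet hQ.
set x := pder 6 2 _ in E2 *.
transitivity (e 0 ^+ 3 * (x *+ 5) *+ 2 - (e 0 ^+ 2 * e 1) ^+ 2 *+ 10); first by ring.
by rewrite E2; ring.
Qed.

(** i is a constant multiple of D^2 Q^2. *)
Lemma cube_quartic : pder 4 0 i *+ 25 = (D * e 0) ^+ 2 *+ 16.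
Proof.
rewrite pder0 // dehom_transvectant // altsum4 /discr.
have [-> -> E2 E3 [E4 _ _]] := cube_jet hQ.
set x2 := pder 6 2 _ in E2 *; set x3 := pder 6 3 _ in E3 *.
set x4 := pder 6 4 _ in E4 *.
transitivity (e 0 ^+ 3 * (x4 *+ 5) *+ 10 - e 0 ^+ 2 * e 1 * (x3 *+ 5) *+ 40
  + (x2 *+ 5) ^+ 2 *+ 6); first by ring.
by rewrite E2 E3 E4; ring.
Qed.

Lemma cube_invariant :
  dehom (transvectant 6 6 6 F F) *+ 5 = D ^+ 3 *+ 16.
Proof.
rewrite dehom_transvectant // altsum6 /discr.
have [-> -> E2 E3 [E4 -> ->]] := cube_jet hQ.
set x2 := pder 6 2 _ in E2 *; set x3 := pder 6 3 _ in E3 *.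
set x4 := pder 6 4 _ in E4 *.
apply: (@polyMn_inj 4) => /=.
transitivity ((e 0 * e 2) ^+ 3 *+ 50 - e 0 ^+ 2 * e 1 ^+ 2 * e 2 ^+ 2 *+ 300
  + (x2 *+ 5) * (x4 *+ 5) *+ 30 - (x3 *+ 5) ^+ 2 *+ 20); first by ring.
by rewrite E2 E3 E4; ring.
Qed.

Lemma cube_covariant_FH : transvectant 6 8 1 F H = 0.
Proof.
apply: (dehom_inj (homog_transvectant _ _ _ _ _)); first exact: dhomog0.
rewrite rmorph0 dehom_transvectant // altsum1.
have [-> -> _ _ _] := cube_jet hQ; have [e0' _ _] := deriv_quad Q.
have E0 := cube_hessian.
have E1 : pder 8 1 H *+ 5 = D * e 0 ^+ 3 * e 1 *+ 2.
  apply: (@polyMn_inj 7); rewrite /= mulrnAC -(deriv_pder _ (isT : 0 < 8)%N) -derivMn E0.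
  by rewrite !(exprS, expr0, mulr1) !(derivMn, derivM) deriv_discr e0'; ring.
apply: (@polyMn_inj 4); rewrite mul0rn /= mulrnBl -!mulrnAr E0 E1; ring.
Qed.

Let di1 : pder 4 1 i *+ 25 = D ^+ 2 * e 0 * e 1 *+ 16.
Proof.
have [e0' _ _] := deriv_quad Q.
apply: (@polyMn_inj 3); rewrite /= mulrnAC -(deriv_pder _ (isT : 0 < 4)%N).
rewrite -derivMn cube_quartic !(exprS, expr0, mulr1) !(derivMn, derivM) deriv_discr e0'.
ring.
Qed.

Let di2 : pder 4 2 i *+ 75 = D ^+ 2 * (e 1 ^+ 2 *+ 2 + e 0 * e 2) *+ 16.
Proof.
have [e0' e1' _] := deriv_quad Q.
rewrite (mulrnA _ 3 25) -(deriv_pder _ (isT : 1 < 4)%N) -derivMn di1.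
rewrite !(exprS, expr0, mulr1) !(derivMn, derivM) deriv_discr e0' e1'.
ring.
Qed.

Lemma cube_covariant_Fi : transvectant 6 4 1 F i = 0.
Proof.
apply: (dehom_inj (homog_transvectant _ _ _ _ _)); first exact: dhomog0.
rewrite rmorph0 dehom_transvectant // altsum1.
have [-> -> _ _ _] := cube_jet hQ.
apply: (@polyMn_inj 24).
by rewrite mul0rn /= mulrnBl -!mulrnAr cube_quartic di1; ring.
Qed.

(** Both terms are multiples of D^3 Q^3: (F,i)^2 is a combination of D_2 f D_0 i,
    D_1 f D_1 i and D_0 f D_2 i that is D^2 times D e_0^3. *)
Lemma cube_covariant_Fi2 :
  8%:R * F * transvectant 6 6 6 F F - 75%:R * transvectant 6 4 2 F i = 0.
Proof.
have hT := homog_transvectant 6 6 6 F F; rewrite /= addn0 in hT.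
apply: (@dehom_inj _ 6); last 1 first.
- rewrite rmorph0 rmorphB (rmorphM _ 75%:R) (rmorphM _ (8%:R * F)) (rmorphM _ _ F).
  rewrite !rmorph_nat /=.
  have E := cube_invariant.
  rewrite [dehom (transvectant 6 4 2 F i)]dehom_transvectant // altsum2 -(pder0 hF).
  have [-> -> E2 _ _] := cube_jet hQ.
  have Ei := cube_quartic.
  set x2 := pder 6 2 _ in E2 *; set T := dehom _ in E *.
  (* Five times each of x2 and T, 25 times i and its first derivative and 75 times
     the second derivative of i are integral in e_0, e_1, e_2. *)
  apply: (@polyMn_inj 4); rewrite mul0rn /=.
  transitivity (e 0 ^+ 3 * (T *+ 5) *+ 8 - ((x2 *+ 5) * (pder 4 0 i *+ 25) *+ 3
    - e 0 ^+ 2 * e 1 * (pder 4 1 i *+ 25) *+ 30 + e 0 ^+ 3 * (pder 4 2 i *+ 75) *+ 5));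
    first by ring.
  by rewrite E E2 Ei di1 di2 /discr; ring.
- rewrite rpredB // mulr_natl; last by rewrite rpredMn // homog_transvectant.
  by rewrite mulrnAl rpredMn // -[6%N]addn0 dhomogM.
- exact: rpred0.
Qed.
End CovariantsOfCube.
End Cubes.

(** * Vanishing of the Jacobian with the Hessian *)

(** The factor 90 clears the denominators of the normalised derivatives, so that
    [h] is 6 f f'' - 5 f'^2. *)
Lemma cube_of_covariant_FH (K : numClosedFieldType) (F : {mpoly K[2]}) :
  F \is 6.-homog -> transvectant 6 8 1 F (transvectant 6 6 2 F F) = 0 ->
  exists2 Q, Q \is 2.-homog & F = Q ^+ 3.
Proof.
set H := transvectant 6 6 2 F F => hF FH0.
have hH : H \is 8.-homog by exact: homog_transvectant.
pose f := dehom F; pose h := dehom H *+ 90.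
have F0 : pder 6 0 F = f := pder0 hF.
have F1 : f^`() = pder 6 1 F *+ 6 by rewrite -F0 deriv_pder.
have F2 : f^`()^`() = pder 6 2 F *+ 30.
  by rewrite F1 derivMn deriv_pder // -mulrnA.
have hE : h = f * f^`()^`() *+ 6 - f^`() ^+ 2 *+ 5.
  by rewrite /h dehom_transvectant // altsum2 F2 F1 F0; ring.
have ode : f^`() * h *+ 4 = f * h^`() *+ 3.
  have := congr1 (@dehom K) FH0; rewrite rmorph0 dehom_transvectant // altsum1.
  rewrite F0 (pder0 hH) => /eqP; rewrite subr_eq0 => /eqP E.
  have H1 : (dehom H)^`() = pder 8 1 H *+ 8 by rewrite -(pder0 hH) deriv_pder.
  rewrite /h derivMn H1 F1.
  transitivity (pder 6 1 F * dehom H *+ 2160); first by ring.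
  by rewrite E; ring.
have [|q fE] := @poly_cube_of_multiplicities _ f.
  by move=> a m g; apply: multiplicity_of_hessian_ode hE ode.
have szq : (size q <= 3)%N.
  have : (size f <= 7)%N by rewrite /f (dehomE hF) size_poly.
  have := size_exp q 3; rewrite -fE; case: (size q) (size f) => [|k] [|l] //=; lia.
have [Q hQ qE] := dehom_surj szq; exists Q => //.
apply: (dehom_inj hF); first exact: (dhomogMn 3 hQ).
by rewrite rmorphXn /= qE -fE.
Qed.

Local Open Scope complex_scope.

Theorem theorem4p4 (R : realType) (F : {mpoly R[i][2]}) (hF : F \is 6.-homog) :
  let H := transvectant 6 6 2 F F in
  let i := transvectant 6 6 4 F F in
  (exists2 Q : {mpoly R[i][2]}, Q \is 2.-homog & F = Q ^+ 3) <->
  [/\ transvectant 6 8 1 F H = 0,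
      transvectant 6 4 1 F i = 0 &
      8%:R * F * transvectant 6 6 6 F F
        - 75%:R * transvectant 6 4 2 F i = 0].
Proof.
split=> [[Q hQ ->]|[FH0 _ _]].
  by split; [exact: cube_covariant_FH | exact: cube_covariant_Fi
            | exact: cube_covariant_Fi2].
exact: cube_of_covariant_FH.
Qed.
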